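(* Let $\alpha\in(0,1)$. There exists $C(\alpha)>0$ such that for every $u\in L^\infty([0,1],C^\alpha(\mathbb T^2))$, all $\kappa\in(0,1)$, $x\in\mathbb T^2$ and $t\in[0,1]$, if $X^\kappa_t$ is a solution to $$dX^\kappa_t=u(t,X^\kappa_t)\,dt+\sqrt{2\kappa}\,dw_t,\qquad X^\kappa_0=x,$$ with $w_t$ a standard Brownian motion in $\mathbb R^2$, then $$\mathrm{Var}(X^\kappa_t)\le C\Big(\kappa t+\big(\|u\|_{L^\infty([0,1],C^\alpha(\mathbb T^2))}\,t\big)^{\frac2{1-\alpha}}\Big).$$
   Context: $\mathbb T^2$ is $[0,\sqrt2]\times[0,1]$ with periodic boundary. For a $\mathbb T^2$-valued random variable $X$ with law $\mu$, $\mathrm{Var}(X):=\inf_{a\in\mathbb T^2}\int_{\mathbb T^2}|x-a|^2\,d\mu(x)$, where $|x-y|$ is the distance in $\mathbb T^2$. The field $u$ takes values in $\mathbb R^2$. *)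

(* Defs.v *)
From HB Require Import structures.
From mathcomp Require Import all_boot all_order all_algebra.
From mathcomp Require Import all_classical all_reals all_analysis.
From mathcomp Require Import ess_sup_inf.
Import Order.TTheory GRing.Theory Num.Theory.
Import numFieldNormedType.Exports.

Set Implicit Arguments.
Unset Strict Implicit.
Unset Printing Implicit Defensive.

Local Open Scope classical_set_scope.
Local Open Scope ring_scope.

(* The norm of [R * R] as a product in the library is the max norm. *)
Definition enorm (R : realType) (v : R * R) : R :=
  Num.sqrt (v.1 ^+ 2 + v.2 ^+ 2).

(* A point of the torus R^2 / (sqrt 2 Z x Z) is given by its representative in
   the fundamental domain [0, sqrt 2[ x [0, 1[. *)
Record torus (R : realType) := Torus {
  torus_rep : R * R;
  _ : (0 <= torus_rep.1 < Num.sqrt 2) && (0 <= torus_rep.2 < 1) }.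

HB.instance Definition _ (R : realType) := [isSub for @torus_rep R].
HB.instance Definition _ (R : realType) := [Choice of torus R by <:].

Lemma torus_mod_subproof (R : realType) (p : R * R) :
  let q := (p.1 - (Num.floor (p.1 / Num.sqrt 2))%:~R * Num.sqrt 2,
            p.2 - (Num.floor p.2)%:~R) in
  (0 <= q.1 < Num.sqrt 2) && (0 <= q.2 < 1).
Proof.
have s0 : 0 < Num.sqrt 2 :> R by rewrite sqrtr_gt0.
have b1 := floor_itv (p.1 / Num.sqrt 2).
have b2 := floor_itv p.2.
move: b1 b2; rewrite !intrD => /andP[b1 b1'] /andP[b2 b2'].
rewrite ler_pdivlMr// in b1; rewrite ltr_pdivrMr// in b1'.
apply/andP; split; apply/andP; split => /=; rewrite ?subr_ge0 ?ltrBlDl//.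
by rewrite mulrDl mul1r in b1'.
Qed.

(* The quotient map R^2 -> T^2. *)
Definition torus_mod (R : realType) (p : R * R) : torus R :=
  Torus (torus_mod_subproof p).

HB.instance Definition _ (R : realType) :=
  isPointed.Build (torus R) (torus_mod 0).

(* Quotient sigma-algebra: it is the Borel sigma-algebra of the torus. *)
Definition torus_measurable (R : realType) : set (set (torus R)) :=
  [set A | measurable (@torus_mod R @^-1` A)].

Lemma torus_measurable0 (R : realType) : torus_measurable (@set0 (torus R)).
Proof. by rewrite /torus_measurable/= preimage_set0. Qed.

Lemma torus_measurableC (R : realType) (A : set (torus R)) :
  torus_measurable A -> torus_measurable (~` A).
Proof. by rewrite /torus_measurable/= preimage_setC; exact: measurableC. Qed.

Lemma torus_measurable_bigcup (R : realType) (A : (set (torus R))^nat) :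
  (forall i, torus_measurable (A i)) -> torus_measurable (\bigcup_i A i).
Proof.
move=> mA; rewrite /torus_measurable/= preimage_bigcup.
by apply: bigcup_measurable => i _; exact: mA.
Qed.

Definition torus_display : measure_display.
Proof. by constructor. Qed.

HB.instance Definition _ (R : realType) :=
  @isMeasurable.Build torus_display (torus R) (@torus_measurable R)
    (@torus_measurable0 R) (@torus_measurableC R) (@torus_measurable_bigcup R).

Definition torus_dist (R : realType) (x y : torus R) : R :=
  inf [set enorm (torus_rep x - torus_rep y + (k.1%:~R * Num.sqrt 2, k.2%:~R))
      | k in [set: int * int]].

Definition torus_var (R : realType) (d : measure_display)
    (Omega : measurableType d) (P : probability Omega R)
    (X : {RV P >-> torus R}) : \bar R :=
  ereal_inf [set (\int[distribution P X]_y ((torus_dist y a) ^+ 2)%:E)%E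
            | a in [set: torus R]].

Definition holder_norm (R : realType) (alpha : R) (f : torus R -> R * R)
    : \bar R :=
  (ereal_sup [set (enorm (f x))%:E | x in [set: torus R]] +
   ereal_sup [set (enorm (f p.1 - f p.2) / torus_dist p.1 p.2 `^ alpha)%:E
             | p in [set p : torus R * torus R | p.1 <> p.2]])%E.

Definition Linf_holder_norm (R : realType) (alpha : R)
    (u : R -> torus R -> R * R) : \bar R :=
  ess_sup (mrestr lebesgue_measure (@measurable_itv R `[0, 1]))
    (fun t => holder_norm alpha (u t)).

(* Elements of L^oo([0, 1], C^alpha(T^2)) are given by jointly Borel
   representatives; values at times outside [0, 1] are irrelevant. *)
Definition Linf_holder (R : realType) (alpha : R)
    (u : R -> torus R -> R * R) : Prop :=
  measurable_fun (`[0 : R, 1] `*` [set: torus R])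
    (fun p : R * torus R => u p.1 p.2) /\
  (Linf_holder_norm alpha u < +oo)%E.

Definition filtration01 (R : realType) (d : measure_display)
    (Omega : measurableType d) (F : R -> set (set Omega)) : Prop :=
  (forall t : R, 0 <= t <= 1 ->
     sigma_algebra setT (F t) /\ F t `<=` @measurable d Omega) /\
  (forall s t : R, 0 <= s -> s <= t -> t <= 1 -> F s `<=` F t).

Definition adapted01 (R : realType) (d d' : measure_display)
    (Omega : measurableType d) (E : measurableType d')
    (F : R -> set (set Omega)) (Y : R -> Omega -> E) : Prop :=
  forall t : R, 0 <= t <= 1 -> forall B, measurable B -> F t (Y t @^-1` B).

Definition increment (R : realType) (Omega : Type) (w : R -> Omega -> R * R)
    (s t : R) (o : Omega) : R * R := w t o - w s o.

(* Standard planar Brownian motion on the time interval [0, 1] relative to the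
   filtration F: for s < t the increment is independent of F s with law
   N(0, (t - s) I_2). The second parameter of [normal_prob] is the standard
   deviation. *)
Definition brownian_motion01 (R : realType) (d : measure_display)
    (Omega : measurableType d) (P : probability Omega R)
    (F : R -> set (set Omega)) (w : R -> Omega -> R * R) : Prop :=
  [/\ adapted01 F w,
      {ae P, forall o, w 0 o = 0},
      {ae P, forall o, {within `[0, 1], continuous (fun t => w t o)}},
      (forall s t : R, 0 <= s -> s < t -> t <= 1 ->
         forall B : set (R * R), measurable B ->
         P (increment w s t @^-1` B) =
         (normal_prob 0 (Num.sqrt (t - s)) \x
          normal_prob 0 (Num.sqrt (t - s)))%E B) &
      (forall s t : R, 0 <= s -> s < t -> t <= 1 ->
         forall (A : set Omega) (B : set (R * R)), F s A -> measurable B ->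
         P (A `&` increment w s t @^-1` B) =
         (P A * P (increment w s t @^-1` B))%E)].

(* (Weak) solution on [0, 1] of dX = u(t, X) dt + sqrt(2 kappa) dw, X_0 = x, on
   the torus. The noise is additive, so the equation is the pathwise integral
   equation read modulo the lattice. *)
Definition sde_solution (R : realType) (d : measure_display)
    (Omega : measurableType d) (P : probability Omega R)
    (F : R -> set (set Omega)) (w : R -> Omega -> R * R)
    (u : R -> torus R -> R * R) (kappa : R) (x : torus R)
    (X : R -> Omega -> torus R) : Prop :=
  [/\ adapted01 F X,
      {ae P, forall o, forall t : R, 0 <= t <= 1 ->
        torus_dist (X s o) (X t o) @[s --> within `[0, 1] (nbhs t)] --> (0 : R)} &
      {ae P, forall o, forall t : R, 0 <= t <= 1 ->
        X t o = torus_mod (torus_rep x +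
          (\int[lebesgue_measure]_(s in `[0, t]) (u s (X s o)).1,
           \int[lebesgue_measure]_(s in `[0, t]) (u s (X s o)).2) +
          Num.sqrt (2 * kappa) *: w t o)}].

(* Main.v *)
Require Import Defs.
From HB Require Import structures.
From mathcomp Require Import all_boot all_order all_algebra.
From mathcomp Require Import all_classical all_reals all_analysis.
From mathcomp Require Import measurable_realfun ess_sup_inf ring lra.
Import Order.TTheory GRing.Theory Num.Theory.
Import numFieldNormedType.Exports.

Set Implicit Arguments.
Unset Strict Implicit.
Unset Printing Implicit Defensive.

(** The variance is an infimum over centres, so it is enough to exhibit one
    centre; the centre used here is the position X_t(b) of one well-chosen
    sample b of the same process.

    For two samples o and b, subtracting the noise sqrt(2 kappa) w from the path
    leaves its drift part, the integral of u(r, X_r). Let J be the integral over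
    [0, t] of the l1 distance between the two drifts u(r, X_r(o)) and
    u(r, X_r(b)). At every time s <= t the distance between X_s(o) and X_s(b)
    is at most J plus the two noises, so the Hölder bound on u gives, with
    N = ||u||, J <= 2 N int_0^t (J + noise)^alpha. The power is dominated by a
    quadratic, y^alpha <= B^alpha (1 + y^2 / B^2), which only asks for the mean
    square of the noise over [0, t]; when B dominates J and the root mean square
    A of the noise, this becomes J <= 14 N t B^alpha. Either J <= A, or B = J
    gives J^(1 - alpha) <= 14 N t; in both cases
    J <= A + (14 N t)^(1 / (1 - alpha)). This is [two_paths_dist_le].

    Taking expectations in o needs only the second moment of w_s, which is of
    order s ([brownian_second_moment_le]), and the expectation of the time
    integral of |w_s|^2. For the latter, continuity of paths and Fatou's lemma
    bound the integral by the lower limit of its Riemann sums ([energy]), and a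
    second application of Fatou's lemma bounds the expectation of that limit
    ([integral_energy_le]). The sample b is one whose noise does not exceed
    twice its mean ([exists_good]).

    The Hölder bound on the drift holds only for almost every time, and one must
    know that r |-> u(r, X_r(o)) is measurable. Paths are continuous for the
    distance of the torus, while the sigma-algebra is transported from the
    fundamental domain; the coordinates of the representative are lower
    semicontinuous functions on the torus, which is enough
    ([measurable_torus_path]). *)

Local Open Scope classical_set_scope.
Local Open Scope ring_scope.

(** * Geometry of the torus *)

Section torus_geometry.
Context {R : realType}.
Implicit Types (p q v : R * R) (y z a : torus R).

Lemma enorm_ge0 v : 0 <= enorm v.
Proof. exact: sqrtr_ge0. Qed.

Lemma enorm_sqr v : enorm v ^+ 2 = v.1 ^+ 2 + v.2 ^+ 2.
Proof. by rewrite sqr_sqrtr// addr_ge0// sqr_ge0. Qed.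

Lemma norm1_le_enorm v : `|v.1| <= enorm v.
Proof. by rewrite -sqrtr_sqr ler_wsqrtr// lerDl sqr_ge0. Qed.

Lemma norm2_le_enorm v : `|v.2| <= enorm v.
Proof. by rewrite -sqrtr_sqr ler_wsqrtr// lerDr sqr_ge0. Qed.

Let dist_set y z := [set enorm (torus_rep y - torus_rep z +
  (k.1%:~R * Num.sqrt 2, k.2%:~R)) | k in [set: int * int]].

Lemma torus_dist_has_inf y z : has_inf (dist_set y z).
Proof.
split; first by eexists; exists (0, 0).
by exists 0 => _ [k _ <-]; exact: enorm_ge0.
Qed.

Lemma torus_dist_le y z k : torus_dist y z <= enorm (torus_rep y - torus_rep z +
  (k.1%:~R * Num.sqrt 2, k.2%:~R)).
Proof. by apply: ge_inf; [case: (torus_dist_has_inf y z)|exists k]. Qed.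

Lemma torus_dist_ge y z c :
  (forall k, c <= enorm (torus_rep y - torus_rep z +
    (k.1%:~R * Num.sqrt 2, k.2%:~R))) -> c <= torus_dist y z.
Proof.
move=> h; apply: lb_le_inf; first by case: (torus_dist_has_inf y z).
by move=> _ [k _ <-].
Qed.

Lemma torus_dist_ge0 y z : 0 <= torus_dist y z.
Proof. by apply: torus_dist_ge => k; exact: enorm_ge0. Qed.

Lemma torus_dist_ltP y z c : torus_dist y z < c <->
  exists k, enorm (torus_rep y - torus_rep z +
    (k.1%:~R * Num.sqrt 2, k.2%:~R)) < c.
Proof.
split=> [/(inf_lt (torus_dist_has_inf y z).1)[_ [k _ <-]] ?|[k h]].
  by exists k.
exact: le_lt_trans (torus_dist_le _ _ k) h.
Qed.

Lemma torus_repK : cancel (@torus_rep R) (@torus_mod R).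
Proof.
move=> y; apply: val_inj => /=; case: y => -[a b] /= /andP[/andP[a0 a1] /andP[b0 b1]].
have s0 : 0 < Num.sqrt 2 :> R by rewrite sqrtr_gt0.
have -> : Num.floor (a / Num.sqrt 2) = 0.
  by apply: floor_def; rewrite add0r divr_ge0 ?ltr_pdivrMr ?mul1r// ltW.
have -> : Num.floor b = 0 by apply: floor_def; rewrite add0r b0 b1.
by rewrite mul0r !subr0.
Qed.

Lemma torus_rep_mod p : exists k : int * int,
  torus_rep (torus_mod p) = p - (k.1%:~R * Num.sqrt 2, k.2%:~R).
Proof. by exists (Num.floor (p.1 / Num.sqrt 2), Num.floor p.2). Qed.

(** The distance is a minimum over lattice translates, so any lift [p] of a point
    may replace its representative. *)
Lemma torus_dist_mod_ltP p z c : torus_dist (torus_mod p) z < c <->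
  exists k, enorm (p - torus_rep z + (k.1%:~R * Num.sqrt 2, k.2%:~R)) < c.
Proof.
rewrite torus_dist_ltP; have [m ->] := torus_rep_mod p.
split=> -[k h].
- exists (k - m); move: h; congr (enorm _ < c).
  case: p m k z => ? ? [? ?] [? ?] [[? ?] ?].
  rewrite /= !intrB mulrBl; congr pair => /=; lra.
- exists (k + m); move: h; congr (enorm _ < c).
  case: p m k z => ? ? [? ?] [? ?] [[? ?] ?].
  rewrite /= !intrD mulrDl; congr pair => /=; lra.
Qed.

(** The quotient map is 1-Lipschitz: this is how the equation satisfied modulo
    the lattice turns into estimates on real integrals. *)
Lemma torus_dist_mod_le p q :
  torus_dist (torus_mod p) (torus_mod q) <= enorm (p - q).
Proof.
have [m mE] := torus_rep_mod p; have [n nE] := torus_rep_mod q.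
apply: le_trans (torus_dist_le _ _ (m - n)) _.
rewrite mE nE le_eqVlt; apply/orP; left; apply/eqP; congr enorm.
case: p q m n {mE nE} => ? ? [? ?] [? ?] [? ?].
rewrite /= !intrB mulrBl; congr pair => /=; lra.
Qed.

Lemma torus_dist_xx y : torus_dist y y = 0.
Proof.
apply/eqP; rewrite eq_le torus_dist_ge0 andbT.
rewrite -{1 2}(torus_repK y); apply: le_trans (torus_dist_mod_le _ _) _.
by rewrite subrr /enorm/= expr0n addr0 sqrtr0.
Qed.

(** For a nonzero translation the triangle inequality leaves at least
    [L - `|a|]. *)
Let period_dist (L a : R) (k : int) : 0 <= L -> `|a| <= L ->
  Num.min `|a| (L - `|a|) <= `|a + k%:~R * L|.
Proof.
move=> L0 aL; have [->|k0] := eqVneq k 0.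
  by rewrite mul0r addr0 ge_min lexx.
rewrite ge_min; apply/orP; right.
have k1 : 1 <= `|k%:~R : R| by rewrite -intr_norm ler1z -gtz0_ge1 normr_gt0.
have : L <= `|k%:~R * L| by rewrite normrM (ger0_norm L0) ler_peMl.
have := ler_normB (a + k%:~R * L) a; rewrite addrAC subrr add0r.
lra.
Qed.

(** Together with its analogue in the second coordinate, this lower bound
    separates points and gives semicontinuity of the coordinates. *)
Lemma torus_dist_ge_min1 y z :
  Num.min `|(torus_rep y).1 - (torus_rep z).1|
    (Num.sqrt 2 - `|(torus_rep y).1 - (torus_rep z).1|) <= torus_dist y z.
Proof.
apply: torus_dist_ge => k; apply: le_trans (norm1_le_enorm _) => /=.
apply: period_dist => //.
case: y z => -[a b] /= /andP[/andP[? ?] _] [[a' b'] /= /andP[/andP[? ?] _]].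
by rewrite ler_norml; lra.
Qed.

Lemma torus_dist_ge_min2 y z :
  Num.min `|(torus_rep y).2 - (torus_rep z).2|
    (1 - `|(torus_rep y).2 - (torus_rep z).2|) <= torus_dist y z.
Proof.
apply: torus_dist_ge => k; apply: le_trans (norm2_le_enorm _) => /=.
rewrite -[k.2%:~R]mulr1; apply: period_dist => //.
case: y z => -[a b] /= /andP[_ /andP[? ?]] [[a' b'] /= /andP[_ /andP[? ?]]].
by rewrite ler_norml; lra.
Qed.

Lemma torus_dist_gt0 y z : y <> z -> 0 < torus_dist y z.
Proof.
move=> yz; rewrite lt_neqAle torus_dist_ge0 andbT eq_sym; apply/eqP => d0.
have := torus_dist_ge_min1 y z; have := torus_dist_ge_min2 y z.
rewrite /= d0 !ge_min !normr_le0 !subr_eq0 !subr_le0.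
case: y z yz {d0} => -[a b] /= H [[a' b'] /= H'] yz.
move: (H) (H') => /andP[/andP[? ?] /andP[? ?]] /andP[/andP[? ?] /andP[? ?]].
move=> /orP[/eqP bb|]; last by rewrite ler_normr; lra.
move=> /orP[/eqP aa|]; last by rewrite ler_normr; lra.
by apply: yz; apply: val_inj => /=; rewrite aa bb.
Qed.

(** The first coordinate of the representative jumps from [sqrt 2] down to [0]
    across the seam of the fundamental domain. A nearby point can therefore have
    a much larger coordinate, when [y] lies on the seam, but not a much smaller
    one, provided that [e] does not exceed the room left above [y]. *)
Lemma torus_rep1_lsc y z e : e <= Num.sqrt 2 - (torus_rep y).1 ->
  torus_dist z y < e -> (torus_rep y).1 - e < (torus_rep z).1.
Proof.
move=> eL /(le_lt_trans (torus_dist_ge_min1 z y)).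
case: y z eL => -[a b] /= /andP[/andP[? ?] _] [[a' b'] /= /andP[/andP[? ?] _]] eL.
rewrite gt_min ltr_norml => /orP[|]; first lra.
by rewrite ltrBlDr -ltrBlDl ltr_normr; lra.
Qed.

Lemma torus_rep2_lsc y z e : e <= 1 - (torus_rep y).2 ->
  torus_dist z y < e -> (torus_rep y).2 - e < (torus_rep z).2.
Proof.
move=> eL /(le_lt_trans (torus_dist_ge_min2 z y)).
case: y z eL => -[a b] /= /andP[_ /andP[? ?]] [[a' b'] /= /andP[_ /andP[? ?]]] eL.
rewrite gt_min ltr_norml => /orP[|]; first lra.
by rewrite ltrBlDr -ltrBlDl ltr_normr; lra.
Qed.

End torus_geometry.

(** * Measurability on the torus *)

(** The product sigma-algebra is generated by cylinders, hence the pairing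
    is measurable on any domain. *)
Lemma measurable_fun_pair_in d d1 d2 (T : measurableType d)
    (T1 : measurableType d1) (T2 : measurableType d2) (D : set T)
    (f : T -> T1) (g : T -> T2) :
  measurable_fun D f -> measurable_fun D g ->
  measurable_fun D (fun x => (f x, g x)).
Proof.
move=> mf mg mD.
pose G := preimage_set_system setT (@fst T1 T2) (@measurable _ T1) `|`
          preimage_set_system setT (@snd T1 T2) (@measurable _ T2).
apply: (measurability G) => // _ [_ [[C mC <-]|[C mC <-]] <-].
- by rewrite setTI; exact: mf.
- by rewrite setTI; exact: mg.
Qed.

Section torus_measurability.
Context {R : realType}.
Implicit Types (p q v : R * R) (y z a : torus R).

Lemma measurable_torus_mod : measurable_fun setT (@torus_mod R).
Proof. by move=> _ A mA; rewrite setTI. Qed.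

Lemma measurable_enorm : measurable_fun setT (@enorm R).
Proof.
apply: (@measurableT_comp _ _ _ _ _ _ (@Num.sqrt R)).
  by apply: continuous_measurable_fun; exact: sqrt_continuous.
by apply: measurable_funD; exact: measurable_funX.
Qed.

Lemma measurable_addr_pair v : measurable_fun setT (fun p => p + v).
Proof. by apply: measurable_fun_pair => /=; exact: measurable_funD. Qed.

(** Sublevel sets pulled back to the plane are countable unions, over the lattice,
    of Euclidean discs. *)
Lemma measurable_torus_dist a : measurable_fun setT (torus_dist (R := R) ^~ a).
Proof.
move=> _; apply: (measurability _ (RGenInftyO.measurableE R)) => // _ [_ [c ->] <-].
rewrite setTI /measurable/= /torus_measurable /=.
have -> : @torus_mod R @^-1` (torus_dist (R := R) ^~ a @^-1` `]-oo, c[) =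
    \bigcup_(k : int * int) [set p |
      enorm (p + (- torus_rep a + (k.1%:~R * Num.sqrt 2, k.2%:~R))) < c].
  apply/seteqP; split => p /=; rewrite in_itv/=.
    by move=> /torus_dist_mod_ltP[k kc]; exists k => //=; rewrite addrA.
  by move=> [k _ /=]; rewrite addrA => kc; apply/torus_dist_mod_ltP; exists k.
apply: countable_bigcupT_measurable; first exact: countableP.
move=> k; have mE : measurable_fun setT (fun p : R * R =>
    enorm (p + (- torus_rep a + (k.1%:~R * Num.sqrt 2, k.2%:~R)))).
  apply: measurableT_comp; first exact: measurable_enorm.
  exact: measurable_addr_pair.
have := mE measurableT `]-oo, c[%classic (measurable_itv _); rewrite setTI.
by congr measurable; apply/seteqP; split => p /=; rewrite in_itv.
Qed.

Let lsc_measurable (D : set R) (h : R -> R) : measurable D ->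
  (forall c t, D t -> c < h t -> \forall s \near within D (nbhs t), c < h s) ->
  measurable_fun D h.
Proof.
move=> mD hh; apply: (measurability _ (RGenOInfty.measurableE R)) => // _ [_ [c ->] <-].
suff nb (t : R) : c < h t -> nbhs (t : subspace D) (h @^-1` `]c, +oo[).
  apply: open_measurable_subspace => //; rewrite openE => t /=.
  by rewrite in_itv/= andbT; exact: nb.
move=> ct; have [Dt|Dt] := pselect (D t).
  suff : within D (nbhs t) (h @^-1` `]c, +oo[) by rewrite nbhs_subspace_in.
  by apply: filterS (hh c t Dt ct) => s /=; rewrite in_itv/= andbT.
suff : globally [set t] (h @^-1` `]c, +oo[) by rewrite (nbhs_subspace_out Dt).
by move=> _ -> /=; rewrite in_itv/= ct.
Qed.

(** The coordinates of the representative along a continuous path are lower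
    semicontinuous; the path is recovered from them by the measurable quotient
    map. *)
Lemma measurable_torus_path (D : set R) (f : R -> torus R) : measurable D ->
  (forall t, D t ->
    torus_dist (f s) (f t) @[s --> within D (nbhs t)] --> (0 : R)) ->
  measurable_fun D f.
Proof.
move=> mD cf.
have near_lt t e : D t -> 0 < e ->
    \forall s \near within D (nbhs t), torus_dist (f s) (f t) < e.
  move=> Dt e0; have /cvgrPdist_lt /(_ e e0) := cf t Dt.
  apply: filterS => s; rewrite sub0r normrN; apply: le_lt_trans.
  exact: ler_norm.
have m1 : measurable_fun D (fun s => (torus_rep (f s)).1).
  apply: lsc_measurable => // c t Dt ct.
  have e0 : 0 < Num.min ((torus_rep (f t)).1 - c)
      (Num.sqrt 2 - (torus_rep (f t)).1).
    by rewrite lt_min !subr_gt0 ct /=; case: (f t) => ? /= /andP[/andP[]].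
  apply: filterS (near_lt t _ Dt e0) => s sd.
  have := @torus_rep1_lsc R _ (f s) _ _ sd; rewrite ge_min lexx orbT => /(_ isT).
  by apply: le_lt_trans; rewrite lerBrDr -lerBrDl ge_min lexx.
have m2 : measurable_fun D (fun s => (torus_rep (f s)).2).
  apply: lsc_measurable => // c t Dt ct.
  have e0 : 0 < Num.min ((torus_rep (f t)).2 - c) (1 - (torus_rep (f t)).2).
    by rewrite lt_min !subr_gt0 ct /=; case: (f t) => ? /= /andP[_ /andP[]].
  apply: filterS (near_lt t _ Dt e0) => s sd.
  have := @torus_rep2_lsc R _ (f s) _ _ sd; rewrite ge_min lexx orbT => /(_ isT).
  by apply: le_lt_trans; rewrite lerBrDr -lerBrDl ge_min lexx.
have m12 := measurable_fun_pair_in m1 m2.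
have := measurable_comp measurableT (@subsetT _ _) measurable_torus_mod m12.
apply: eq_measurable_fun => s _ /=.
by rewrite -surjective_pairing torus_repK.
Qed.

End torus_measurability.

(** * Measures with a density and Gaussian second moments *)

Section density.
Context d (T : measurableType d) (R : realType).
Variables (mu nu : {measure set T -> \bar R}) (g : T -> R).
Hypothesis g0 : forall x, 0 <= g x.
Hypothesis mg : measurable_fun setT g.
Hypothesis nuE : forall A, measurable A -> nu A = (\int[mu]_(x in A) (g x)%:E)%E.

Import HBNNSimple.
Local Open Scope ereal_scope.

Let integral_density_nnsfun (f : {nnsfun T >-> R}) :
  \int[nu]_x (f x)%:E = \int[mu]_x ((f x)%:E * (g x)%:E).
Proof.
under [LHS]eq_integral do rewrite fimfunE -fsumEFin//.
rewrite [LHS]ge0_integral_fsum//; last 2 first.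
  - by move=> r; exact/measurable_EFinP/measurableT_comp.
  - by move=> n x _; rewrite EFinM nnfun_muleindic_ge0.
under [RHS]eq_integral.
  move=> x xD; rewrite fimfunE -fsumEFin// muleC ge0_mule_fsumr; last first.
    by move=> r; rewrite EFinM nnfun_muleindic_ge0.
  over.
rewrite [RHS]ge0_integral_fsum//; last 2 first.
  - move=> r; apply/measurable_EFinP; apply: measurable_funM => //.
    exact/measurableT_comp.
  - move=> n x _; rewrite EFinM mule_ge0//; last by rewrite nnfun_muleindic_ge0.
    by rewrite lee_fin.
apply: eq_fsbigr => r; rewrite inE => -[t _ rE].
have r0 : (0 <= r)%R by rewrite -rE.
have mA : measurable (f @^-1` [set r]) by [].
rewrite integralZl_indic_nnsfun// integral_indic// setIT nuE//.
rewrite -(ge0_integralZl_EFin mu mA)//; last 2 first.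
  by move=> x _; rewrite lee_fin.
  by apply/measurable_EFinP; exact: measurable_funTS.
rewrite integral_mkcond; apply: eq_integral => x _.
rewrite patchE indicE; case: ifPn => _; first by rewrite mulr1 muleC.
by rewrite mulr0 mule0.
Qed.

(** True for simple functions by linearity, then by monotone convergence. *)
Lemma ge0_integral_density (f : T -> \bar R) :
  measurable_fun setT f -> (forall x, 0 <= f x) ->
  \int[nu]_x f x = \int[mu]_x (f x * (g x)%:E).
Proof.
move=> mf f0; pose f_ := nnsfun_approx measurableT mf.
have cf x : EFin \o f_^~ x @ \oo --> f x by exact: cvg_nnsfun_approx.
transitivity (lim (\int[nu]_x (f_ n x)%:E @[n --> \oo])).
  rewrite -monotone_convergence//=.
  - by apply: eq_integral => x _; apply/esym/cvg_lim => //; exact: cf.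
  - by move=> n; exact/measurable_EFinP/measurable_funTS.
  - by move=> n ? _; rewrite lee_fin.
  - by move=> ? _ ? ? mn; rewrite lee_fin; exact/lefP/nd_nnsfun_approx.
under eq_fun do rewrite integral_density_nnsfun.
rewrite -monotone_convergence//=.
- apply: eq_integral => x _; apply/cvg_lim => //.
  by apply: cvgeZr => //; exact: cf.
- move=> n; apply: emeasurable_funM; first exact/measurable_EFinP/measurable_funTS.
  exact/measurable_EFinP.
- by move=> n x _; rewrite mule_ge0// lee_fin.
- move=> x _ m n mn; have fmn : (f_ m x)%:E <= (f_ n x)%:E.
    by rewrite lee_fin; exact/lefP/nd_nnsfun_approx.
  by apply: lee_wpmul2r fmn; rewrite lee_fin.
Qed.

End density.

(** With [y = x ^+ 2 / (4 * s ^+ 2)], the inequality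
    [y * expR (- y) <= 1] trades half of the Gaussian exponent for the factor
    [x ^+ 2], and what remains is the density of variance [2 * s ^+ 2], of total
    mass one. *)
Lemma normal_second_moment_le (R : realType) (s : R) : 0 < s ->
  (\int[normal_prob 0 s]_x (x ^+ 2)%:E <= (8 * s ^+ 2)%:E)%E.
Proof.
move=> s0; have sn0 : s != 0 by rewrite gt_eqF.
pose s' := s * Num.sqrt 2.
have s'2 : s' ^+ 2 = s ^+ 2 * 2 by rewrite exprMn sqr_sqrtr.
have s'0 : s' != 0 by rewrite mulf_neq0// gt_eqF// sqrtr_gt0.
rewrite (@ge0_integral_density _ _ _ lebesgue_measure _
  (normal_pdf 0 s)) //=; last 4 first.
- exact: normal_pdf_ge0.
- exact: measurable_normal_pdf.
- by apply/measurable_EFinP; exact: measurable_funX.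
- by move=> x; rewrite lee_fin sqr_ge0.
have -> : ((8 * s ^+ 2)%:E = \int[lebesgue_measure]_x
    ((8 * s ^+ 2)%:E * (normal_pdf 0 s' x)%:E))%E.
  rewrite ge0_integralZl_EFin//.
  - by rewrite integral_normal_pdf mule1.
  - by move=> x _; rewrite lee_fin normal_pdf_ge0.
  - by apply/measurable_EFinP; exact: measurable_normal_pdf.
  - by rewrite mulr_ge0// sqr_ge0.
apply: ge0_le_integral => //=.
- by move=> x _; rewrite mule_ge0// lee_fin ?sqr_ge0 ?normal_pdf_ge0.
- apply: emeasurable_funM; apply/measurable_EFinP; first exact: measurable_funX.
  exact: measurable_normal_pdf.
- by apply: emeasurable_funM => //; apply/measurable_EFinP; exact: measurable_normal_pdf.
move=> x _; rewrite -!EFinM lee_fin !normal_pdfE//.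
rewrite /normal_peak /normal_fun !subr0 s'2.
have -> : s ^+ 2 * 2 * pi *+ 2 = (s ^+ 2 * pi *+ 2) * 2.
  by rewrite mulrAC mulrnAl.
have p0 : 0 <= s ^+ 2 * pi *+ 2 by rewrite mulrn_wge0// mulr_ge0 ?sqr_ge0 ?pi_ge0.
rewrite (sqrtrM _ p0) invfM; set P := (Num.sqrt _)^-1.
have P0 : 0 <= P by rewrite invr_ge0 sqrtr_ge0.
pose y := x ^+ 2 / (s ^+ 2 * 2 *+ 2).
have -> : - x ^+ 2 / (s ^+ 2 *+ 2) = - y - y.
  by rewrite /y; field.
have -> : - x ^+ 2 / (s ^+ 2 * 2 *+ 2) = - y by rewrite mulNr.
have -> : x ^+ 2 = (4 * s ^+ 2) * y by rewrite /y; field.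
rewrite expRD.
have ye : y * expR (- y) <= 1.
  rewrite expRN -ler_pdivlMr ?invr_gt0 ?expR_gt0// invrK mul1r.
  by have := expR_ge1Dx y; lra.
have q0 : 0 <= 4 * s ^+ 2 * P * expR (- y).
  apply: mulr_ge0 (expR_ge0 _); apply: mulr_ge0 P0.
  by rewrite mulr_ge0 ?sqr_ge0.
apply: (@le_trans _ _ (4 * s ^+ 2 * P * expR (- y))).
  by rewrite -[leRHS]mulr1; apply: le_trans (ler_wpM2l q0 ye); lra.
have : 1 <= 2 * (Num.sqrt 2)^-1 :> R.
  rewrite ler_pdivlMr ?sqrtr_gt0// mul1r.
  rewrite -[leRHS]ger0_norm// -sqrtr_sqr ler_wsqrtr//; lra.
by move=> /(ler_wpM2l q0); lra.
Qed.

(** * Riemann sums of continuous functions *)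

Section riemann_sums.
Context {R : realType}.
Local Notation mu := (@lebesgue_measure R).

Definition grid (t : R) (n i : nat) : R := t * i%:R / n.+1%:R.

Definition riemann_sum (t : R) (f : R -> R) (n : nat) : R :=
  \sum_(i < n.+1) f (grid t n i) * (t / n.+1%:R).

Lemma grid_bound (t : R) n (i : 'I_n.+1) : 0 <= t -> 0 <= grid t n i <= t.
Proof.
move=> t0; rewrite /grid divr_ge0 ?mulr_ge0//= ler_pdivrMr ?ltr0n//.
by rewrite ler_wpM2l// ler_nat ltnW.
Qed.

Let left_point (t : R) n (x : R) : R := grid t n (Num.truncn (x * n.+1%:R / t)).

Let left_point_itv (t : R) n (x : R) : 0 < t -> 0 <= x ->
  left_point t n x <= x < left_point t n x + t / n.+1%:R.
Proof.
move=> t0 x0; have n0 : 0 < n.+1%:R :> R by rewrite ltr0n.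
have /truncn_itv/andP[] : 0 <= x * n.+1%:R / t by rewrite divr_ge0 ?mulr_ge0// ltW.
set k := Num.truncn _; rewrite ler_pdivlMr// ltr_pdivrMr// -[k.+1%:R]natr1 => h1 h2.
rewrite /left_point /grid -/k ler_pdivrMr// mulrC h1 /= -mulrDl ltr_pdivlMr//.
by apply: (lt_le_trans h2); rewrite mulrDl mul1r mulrC.
Qed.

Let cvg_left_point (t x : R) : 0 < t -> 0 <= x -> left_point t n x @[n --> \oo] --> x.
Proof.
move=> t0 x0; apply: (@squeeze_cvgr _ _ _ _ (fun n => x - t / n.+1%:R) (fun=> x)).
- apply: nearW => n; have /andP[h1 h2] := left_point_itv n t0 x0.
  by rewrite h1 andbT lerBlDr ltW.
- rewrite -[X in _ --> X]subr0; apply: cvgB; first exact: cvg_cst.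
  rewrite -[X in _ --> X](mulr0 t); apply: cvgM; first exact: cvg_cst.
  exact: cvg_harmonic.
- exact: cvg_cst.
Qed.

(** The Riemann sum dominates the integral of the step function [step n], which
    converges pointwise to [f] on [[0, t[]; Fatou's lemma concludes. *)
Lemma integral_le_liminf_riemann_sum (t : R) (f : R -> R) : 0 < t ->
  {within `[0, t], continuous f} -> (forall x, 0 <= x <= t -> 0 <= f x) ->
  (\int[mu]_(x in `[0%R, t]) (f x)%:E <=
   limn_einf (fun n => (riemann_sum t f n)%:E))%E.
Proof.
move=> t0 cf f0.
pose A n i : set R := [set` `[grid t n i, grid t n i + t / n.+1%:R[%R].
pose step n x : \bar R := (\sum_(i < n.+1) (f (grid t n i))%:E * (\1_(A n i) x)%:E)%E.
have stepE (n : nat) (x : R) : 0 <= x < t -> step n x = (f (left_point t n x))%:E.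
  move=> /andP[x0 xt]; have n0 : 0 < n.+1%:R :> R by rewrite ltr0n.
  have : (Num.truncn (x * n.+1%:R / t) < n.+1)%N.
    rewrite -(ltr_nat R).
    have /truncn_itv/andP[h1 _] : 0 <= x * n.+1%:R / t.
      by rewrite divr_ge0 ?mulr_ge0// ltW.
    by apply: (le_lt_trans h1); rewrite ltr_pdivrMr// mulrC ltr_pM2l.
  move=> kn; rewrite /step (bigD1 (Ordinal kn))//= big1 ?adde0.
    have Ax : A n (Num.truncn (x * n.+1%:R / t)) x.
      by rewrite /A/= in_itv/=; exact: left_point_itv.
    by rewrite indicE mem_set// mule1.
  move=> i ik; suff nAx : ~ A n i x by rewrite indicE memNset// mule0.
  rewrite /A/= in_itv/= => /andP[i1 i2].
  move/eqP: ik; apply; apply: val_inj => /=; apply/esym/truncn_def.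
  rewrite ler_pdivlMr// ltr_pdivrMr//.
  move: i1 i2; rewrite /grid ler_pdivrMr// -mulrDl ltr_pdivlMr// -[i.+1%:R]natr1.
  by rewrite mulrDl mul1r mulrC => -> /=; rewrite mulrC.
have mco : measurable_fun `[0, t[ (EFin \o f).
  apply/measurable_EFinP; apply: measurable_funS (_ : measurable_fun `[0, t] f) => //.
    by apply: subset_itvl; rewrite bnd_simp.
  exact: subspace_continuous_measurable_fun.
rewrite -integral_itv_bndo_bndc//.
have mstepi (n : nat) (i : 'I_n.+1) : measurable_fun `[0, t[
    (fun x => (f (grid t n i))%:E * (\1_(A n i) x)%:E)%E.
  apply: measurable_funTS; apply: emeasurable_funM => //.
  by apply/measurable_EFinP; apply: measurable_indic; exact: measurable_itv.
have mstep (n : nat) : measurable_fun `[0, t[ (step n).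
  by apply: emeasurable_sum => i _; exact: mstepi.
have f0g (n : nat) (i : 'I_n.+1) : 0 <= f (grid t n i).
  by apply: f0; exact/grid_bound/ltW.
have step0 (n : nat) (x : R) : (`[0, t[%classic : set R) x -> (0 <= step n x)%E.
  by move=> _; apply: sume_ge0 => i _; rewrite mule_ge0// lee_fin.
have -> : (\int[mu]_(x in `[0%R, t[) (f x)%:E =
    \int[mu]_(x in `[0%R, t[) limn_einf (step ^~ x))%E.
  apply: eq_integral => x; rewrite inE/= in_itv/= => x0t.
  have /andP[x0 xt] := x0t.
  apply/esym; apply: (cvg_limn_einf_sup _).1.
  under eq_fun do rewrite stepE//.
  apply/cvg_EFin; first exact: nearW.
  have xin : (`[0, t]%classic : set R) x by rewrite /= in_itv/= x0 ltW.
  have /subspace_continuousP/(_ x xin) cfx := cf.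
  apply: (cvg_comp (fun n => left_point t n x) f _ cfx) => B nB.
  have : \forall n \near \oo, (`[0, t]%classic : set R) (left_point t n x) ->
      B (left_point t n x) := cvg_left_point t0 x0 nB.
  suff : \forall n \near \oo, (`[0, t]%classic : set R) (left_point t n x).
    by apply: filterS2 => n xn; exact.
  apply: nearW => n; rewrite /= in_itv/=.
  have /andP[lx _] := left_point_itv n t0 x0.
  rewrite (le_trans lx (ltW xt)) andbT /left_point /grid.
  by rewrite divr_ge0// mulr_ge0// ltW.
apply: le_trans (fatou _ _ _ _) _ => //.
rewrite !limn_einf_lim; apply: lee_lim; [exact: is_cvg_einfs|exact: is_cvg_einfs|].
apply: nearW => n; apply: le_ereal_inf_tmp => _ [m /= nm <-].
apply: (@le_trans _ _ (\int[mu]_(x in `[0%R, t[) step m x)%E).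
  by apply: ereal_inf_lbound; exists m.
rewrite /step ge0_integral_sum//; last 2 first.
- exact: mstepi.
- by move=> i x _; rewrite mule_ge0// lee_fin.
rewrite /riemann_sum -sumEFin; apply: lee_sum => i _.
have mAi : measurable (A m i) by exact: measurable_itv.
rewrite ge0_integralZl_EFin//; last first.
  by apply/measurable_EFinP; exact: measurable_indic.
rewrite EFinM lee_wpmul2l// ?lee_fin// integral_indic//.
apply: (@le_trans _ _ (mu (A m i))).
  by apply: le_measure; rewrite ?inE//; exact: measurableI.
rewrite /A lebesgue_measure_itv/= lte_fin ltrDl divr_gt0// -EFinD.
by rewrite addrAC subrr add0r.
Qed.

End riemann_sums.

(** * The energy of Brownian paths *)

Lemma limn_einf_le {R : realType} (u : (\bar R)^nat) (c : \bar R) :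
  (forall n, u n <= c)%E -> (limn_einf u <= c)%E.
Proof.
move=> uc; rewrite limn_einf_lim; apply: lime_le; first exact: is_cvg_einfs.
apply: nearW => n; apply: le_trans (uc n).
by apply: ereal_inf_lbound; exists n => /=.
Qed.

Lemma limn_einf_ge0 {R : realType} (u : (\bar R)^nat) :
  (forall n, 0 <= u n)%E -> (0 <= limn_einf u)%E.
Proof.
move=> u0; rewrite limn_einf_lim; apply: lime_ge; first exact: is_cvg_einfs.
by apply: nearW => n; apply: le_ereal_inf_tmp => _ [m _ <-].
Qed.

Lemma measurable_fun_limn_einf d (T : measurableType d) (R : realType)
    (u : (T -> \bar R)^nat) : (forall n, measurable_fun setT (u n)) ->
  measurable_fun setT (fun x => limn_einf (u ^~ x)).
Proof.
move=> mu; apply: measurableT_comp => //.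
apply: (measurable_fun_limn_esup (f := fun n x => (- u n x)%E)) => n.
by apply: measurableT_comp => //; exact: mu.
Qed.

Section brownian_moments.
Context {R : realType} d (Omega : measurableType d) (P : probability Omega R).
Variables (F : R -> set (set Omega)) (w : R -> Omega -> R * R).
Hypotheses (hF : filtration01 F) (hw : brownian_motion01 P F w).

Lemma measurable_brownian s : 0 <= s <= 1 -> measurable_fun setT (w s).
Proof.
move=> s01 _ B mB; rewrite setTI.
have [_ FM] := hF.1 s s01; apply: FM.
by case: hw => + _ _ _ _; apply.
Qed.

Lemma measurable_enorm_brownian s : 0 <= s <= 1 ->
  measurable_fun setT (fun o => enorm (w s o) ^+ 2).
Proof.
move=> s01; apply: measurable_funX; apply: measurableT_comp.
  exact: measurable_enorm.
exact: measurable_brownian.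
Qed.

(** Only the law of [phi] matters, so the integral is one against [normal_prob]. *)
Let gauss_second_moment (phi : Omega -> R) (s : R) : 0 < s ->
  measurable_fun setT phi ->
  (forall B, measurable B -> P (phi @^-1` B) = normal_prob 0 (Num.sqrt s) B) ->
  (\int[P]_o (phi o ^+ 2)%:E <= (8 * s)%:E)%E.
Proof.
move=> s0 mphi law.
have m2 : measurable_fun setT (fun x : R => (x ^+ 2)%:E).
  by apply/measurable_EFinP; exact: measurable_funX.
(* [normal_prob] is a measure on [measurableTypeR R], a copy of [R]. *)
pose phi' : Omega -> measurableTypeR R := phi.
pose mixin := isMeasurableFun.Build _ _ _ _ phi' mphi.
pose X : {RV P >-> measurableTypeR R} := HB.pack phi' mixin.
have -> : (\int[P]_o (phi o ^+ 2)%:E = \int[distribution P X]_x (x ^+ 2)%:E)%E.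
  by rewrite ge0_integral_distribution// => x; rewrite lee_fin sqr_ge0.
rewrite (eq_measure_integral (normal_prob 0 (Num.sqrt s)))/=; last first.
  by move=> B mB _; exact: law.
apply: le_trans (normal_second_moment_le _) _; first by rewrite sqrtr_gt0.
by rewrite sqr_sqrtr// ltW.
Qed.

(** Almost surely [w s] is the increment from time [0], whose two coordinates
    are centred Gaussians of variance [s]. *)
Lemma brownian_second_moment_le s : 0 <= s <= 1 ->
  (\int[P]_o (enorm (w s o) ^+ 2)%:E <= (16 * s)%:E)%E.
Proof.
move=> s01; have /andP[s0 s1] := s01.
have c01 : 0 <= (0 : R) <= 1 by rewrite lexx ler01.
have mw := measurable_brownian s01; have mw0 := measurable_brownian c01.
pose v o : R * R := increment w 0 s o.
have mv1 : measurable_fun setT (fun o => (v o).1).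
  by apply: measurable_funB; apply: measurableT_comp.
have mv2 : measurable_fun setT (fun o => (v o).2).
  by apply: measurable_funB; apply: measurableT_comp.
have mw2 := measurable_enorm_brownian s01.
have mv1s : measurable_fun setT (fun o => ((v o).1 ^+ 2)%:E).
  by apply/measurable_EFinP; exact: measurable_funX.
have mv2s : measurable_fun setT (fun o => ((v o).2 ^+ 2)%:E).
  by apply/measurable_EFinP; exact: measurable_funX.
have -> : (\int[P]_o (enorm (w s o) ^+ 2)%:E =
    \int[P]_o (((v o).1 ^+ 2)%:E + ((v o).2 ^+ 2)%:E))%E.
  apply: ge0_ae_eq_integral => //.
  - exact/measurable_EFinP.
  - exact: emeasurable_funD.
  - by move=> o _; rewrite lee_fin sqr_ge0.
  - by move=> o _; rewrite adde_ge0// lee_fin sqr_ge0.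
  case: hw => _ w00 _ _ _; apply: filterS w00 => o w00 _.
  by rewrite -EFinD enorm_sqr /v /increment w00 subr0.
rewrite ge0_integralD//; last 2 first.
- by move=> o _; rewrite lee_fin sqr_ge0.
- by move=> o _; rewrite lee_fin sqr_ge0.
have [sE|s_neq0] := eqVneq s 0.
  rewrite !integral0_eq ?adde0 ?lee_fin ?mulr_ge0// => o _;
  by rewrite /v /increment sE subrr expr0n.
have s_gt0 : 0 < s by rewrite lt_neqAle eq_sym s_neq0.
have -> : (16 * s)%:E = ((8 * s)%:E + (8 * s)%:E)%E by rewrite -EFinD; congr EFin; lra.
case: hw => _ _ _ law _.
have lawv B := law 0 s (lexx _) s_gt0 s1 B.
rewrite subr0 in lawv.
apply: leeD; apply: gauss_second_moment => //.
- move=> B mB; have := lawv (B `*` setT) (measurableX mB measurableT).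
  rewrite product_measure1E//.
  rewrite [X in (_ * X)%E](probability_setT (normal_prob 0 (Num.sqrt s))) mule1 => <-.
  by congr (P _); apply/seteqP; split => o /=; [split|case].
- move=> B mB; have := lawv (setT `*` B) (measurableX measurableT mB).
  rewrite product_measure1E//.
  rewrite [X in (X * _)%E](probability_setT (normal_prob 0 (Num.sqrt s))) mul1e => <-.
  by congr (P _); apply/seteqP; split => o /=; [split|case].
Qed.

(** A substitute for the integral of [enorm (w s o) ^+ 2] over [[0, t]] which is
    measurable in [o] because it involves countably many times only. *)
Definition energy (t : R) (o : Omega) : \bar R :=
  limn_einf (fun n => (riemann_sum t (fun s => enorm (w s o) ^+ 2) n)%:E).

Let grid01 (t : R) n (i : 'I_n.+1) : 0 <= t <= 1 -> 0 <= grid t n i <= 1.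
Proof.
move=> /andP[t0 t1]; have /andP[-> h] := grid_bound i t0.
exact: le_trans h t1.
Qed.

Let mterm (t : R) n (i : 'I_n.+1) : 0 <= t <= 1 -> measurable_fun setT
  (fun o => enorm (w (grid t n i) o) ^+ 2 * (t / n.+1%:R)).
Proof.
move=> t01; apply: measurable_funM => //.
by apply: measurable_enorm_brownian; exact: grid01.
Qed.

Let measurable_riemann (t : R) n : 0 <= t <= 1 -> measurable_fun setT
  (fun o => (riemann_sum t (fun s => enorm (w s o) ^+ 2) n)%:E).
Proof.
move=> t01; apply/measurable_EFinP.
by apply: measurable_sum => i; exact: mterm.
Qed.

Let term_ge0 (t : R) n (i : 'I_n.+1) o : 0 <= t <= 1 ->
  0 <= enorm (w (grid t n i) o) ^+ 2 * (t / n.+1%:R).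
Proof. by move=> /andP[t0 _]; rewrite mulr_ge0 ?sqr_ge0// divr_ge0. Qed.

Let riemann_ge0 (t : R) n o : 0 <= t <= 1 ->
  (0 <= (riemann_sum t (fun s => enorm (w s o) ^+ 2) n)%:E)%E.
Proof. by move=> t01; rewrite lee_fin sumr_ge0// => i _; exact: term_ge0. Qed.

Lemma measurable_energy t : 0 <= t <= 1 -> measurable_fun setT (energy t).
Proof.
by move=> t01; apply: measurable_fun_limn_einf => n; exact: measurable_riemann.
Qed.

Lemma energy_ge0 t o : 0 <= t <= 1 -> (0 <= energy t o)%E.
Proof. by move=> t01; apply: limn_einf_ge0 => n; exact: riemann_ge0. Qed.

(** Fatou's lemma in the sample, then the second moment at each grid point. *)
Lemma integral_energy_le t : 0 <= t <= 1 ->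
  (\int[P]_o energy t o <= (16 * t ^+ 2)%:E)%E.
Proof.
move=> t01; have /andP[t0 t1] := t01.
apply: le_trans (fatou _ _ _ _) _ => //.
- by move=> n; exact: measurable_riemann.
- by move=> n o _; exact: riemann_ge0.
apply: limn_einf_le => n.
rewrite /riemann_sum; under eq_integral do rewrite -sumEFin.
rewrite ge0_integral_sum//; last 2 first.
- by move=> i; apply/measurable_EFinP; exact: mterm.
- by move=> i o _; rewrite lee_fin; exact: term_ge0.
apply: (@le_trans _ _ (\sum_(i < n.+1) ((16 * t) * (t / n.+1%:R))%:E)%E).
  apply: lee_sum => i _; under eq_integral do rewrite mulrC EFinM.
  have tn0 : 0 <= t / n.+1%:R by rewrite divr_ge0.
  rewrite ge0_integralZl_EFin//; last 2 first.
  - by move=> o _; rewrite lee_fin sqr_ge0.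
  - by apply/measurable_EFinP; apply: measurable_enorm_brownian; exact: grid01.
  rewrite [X in (_ <= X%:E)%E]mulrC [leRHS]EFinM.
  apply: lee_wpmul2l; first by rewrite lee_fin.
  apply: le_trans (brownian_second_moment_le (grid01 i t01)) _.
  by rewrite lee_fin ler_pM2l//; case/andP: (grid_bound i t0).
rewrite sumEFin lee_fin sumr_const card_ord -[leLHS]mulr_natr.
by rewrite -!mulrA mulVf ?pnatr_eq0// mulr1 expr2.
Qed.

(** Ties the measurable [energy] to the path integral by which
    [two_paths_dist_le] measures the noise. *)
Lemma integral_le_energy t : 0 < t <= 1 -> {ae P, forall o,
  lebesgue_measure.-integrable `[0, t]
    (fun s : measurableTypeR R => (enorm (w s o) ^+ 2)%:E) /\
  ((\int[lebesgue_measure]_(s in `[0%R, t]) (enorm (w s o) ^+ 2))%:E <=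
    energy t o)%E}.
Proof.
move=> /andP[t0 t1]; case: hw => _ _ cw _ _; apply: filterS cw => o cw.
have cf : {within `[0, 1], continuous (fun s : R => enorm (w s o) ^+ 2)}.
  have -> : (fun s => enorm (w s o) ^+ 2) =
      (fun s => (w s o).1 * (w s o).1 + (w s o).2 * (w s o).2).
    by apply/funext => s; rewrite enorm_sqr !expr2.
  have cw1 : {within `[0, 1], continuous (fun s => (w s o).1)}.
    by move=> x; apply: (cvg_comp _ _ (cw x)); exact: cvg_fst.
  have cw2 : {within `[0, 1], continuous (fun s => (w s o).2)}.
    by move=> x; apply: (cvg_comp _ _ (cw x)); exact: cvg_snd.
  by move=> x; apply: cvgD; apply: cvgM;
    [exact: cw1|exact: cw1|exact: cw2|exact: cw2].
have cft : {within `[0, t], continuous (fun s : R => enorm (w s o) ^+ 2)}.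
  apply: continuous_subspaceW cf.
  by apply: subset_itvl; rewrite bnd_simp.
have fi := continuous_compact_integrable (@segment_compact R 0 t) cft.
split; first exact: fi.
have := integral_le_liminf_riemann_sum t0 cft (fun s _ => sqr_ge0 _).
by apply: le_trans; rewrite fineK//; apply: integrable_fin_num.
Qed.

End brownian_moments.

(** * Scalar estimates and integrals up to null sets *)

Section scalar_estimates.
Context {R : realType} (alpha : R).
Hypotheses (alpha0 : 0 < alpha) (alpha1 : alpha < 1).

(** Below [B] the power is at most [B `^ alpha]; above [B], monotonicity in the
    exponent applied to [y / B >= 1] replaces [alpha] by [2]. *)
Lemma powR_le_quadratic (B y : R) : 0 < B -> 0 <= y ->
  y `^ alpha <= B `^ alpha * (1 + y ^+ 2 / B ^+ 2).
Proof.
move=> B0 y0; have Ba : 0 <= B `^ alpha by exact: powR_ge0.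
have q0 : 0 <= y ^+ 2 / B ^+ 2 by rewrite divr_ge0// sqr_ge0.
have [yB|By] := leP y B.
  apply: (@le_trans _ _ (B `^ alpha)).
    by apply: ge0_ler_powR; rewrite ?nnegrE// ltW.
  by rewrite ler_peMr// lerDl.
have yE : y = B * (y / B) by rewrite mulrC divfK// gt_eqF.
have yB1 : 1 <= y / B by rewrite ler_pdivlMr// mul1r ltW.
rewrite {1}yE powRM ?divr_ge0 ?(ltW B0)//; apply: ler_wpM2l => //.
rewrite -exprVn -exprMn; apply: (@le_trans _ _ ((y / B) ^+ 2)); last by rewrite lerDr.
rewrite -powR_mulrn ?divr_ge0 ?(ltW B0)//; apply: ler_powR => //.
by rewrite (le_trans (ltW alpha1))// ler1n.
Qed.

(** If [J] exceeds [A] then [B = J] is admissible and the sublinear inequality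
    [J <= K * J `^ alpha] can be solved for [J]. *)
Lemma sublinear_fixpoint_le (A J K : R) : 0 < A -> 0 <= J -> 0 <= K ->
  (forall B, A <= B -> J <= B -> J <= K * B `^ alpha) ->
  J <= A + K `^ (1 - alpha)^-1.
Proof.
move=> A0 J0 K0 h; have Kp : 0 <= K `^ (1 - alpha)^-1 by exact: powR_ge0.
have [JA|AJ] := leP J A; first by rewrite (le_trans JA)// lerDl.
have Jp : 0 < J by exact: lt_trans AJ.
have b0 : 0 < 1 - alpha by rewrite subr_gt0.
have JK : J `^ (1 - alpha) <= K.
  have := h J (ltW AJ) (lexx _); rewrite -ler_pdivrMr ?powR_gt0//.
  by rewrite powRB// ?powRr1 ?(ltW Jp)//; apply/implyP => _; rewrite gt_eqF.
have -> : J = (J `^ (1 - alpha)) `^ (1 - alpha)^-1.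
  by rewrite -powRrM mulfV ?gt_eqF// powRr1// ltW.
apply: (@le_trans _ _ (K `^ (1 - alpha)^-1)); last by rewrite lerDr ltW.
by apply: ge0_ler_powR; rewrite ?nnegrE ?powR_ge0// invr_ge0 ltW.
Qed.

End scalar_estimates.

Section Rintegral_ae.
Context d (T : measurableType d) (R : realType) (mu : {measure set T -> \bar R}).
Implicit Types (D : set T) (f h : T -> R).

Lemma ae_imp (A B : T -> Prop) : (forall x, A x -> B x) ->
  {ae mu, forall x, A x} -> {ae mu, forall x, B x}.
Proof. by move=> AB; apply: filterS. Qed.

Lemma ae_bounded_integrable D f (M : R) : measurable D -> (mu D < +oo)%E ->
  measurable_fun D f -> {ae mu, forall x, D x -> `|f x| <= M} ->
  mu.-integrable D (EFin \o f).
Proof.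
move=> mD Doo mf fM; apply/integrableP; split; first exact/measurable_EFinP.
have mM : 0 <= `|M| by [].
apply: (@le_lt_trans _ _ (\int[mu]_(x in D) `|M|%:E)%E).
  apply: ae_ge0_le_integral => //=.
  - by apply/measurable_EFinP; apply: measurableT_comp.
  by apply: filterS fM => x fM Dx; rewrite lee_fin (le_trans (fM Dx))// ler_norm.
by rewrite integral_cst//; apply: lte_mul_pinfty => //; rewrite ?lee_fin.
Qed.

Lemma integrable_dist D f h : measurable D ->
  mu.-integrable D (EFin \o f) -> mu.-integrable D (EFin \o h) ->
  mu.-integrable D (EFin \o (fun x => `|f x - h x|)).
Proof.
move=> mD fi hi; apply: (integrable_norm (f := fun x => f x - h x)).
exact: (integrableB mD fi hi).
Qed.

Lemma ae_le_Rintegral D f h : measurable D ->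
  mu.-integrable D (EFin \o f) -> mu.-integrable D (EFin \o h) ->
  (forall x, D x -> 0 <= f x) -> (forall x, D x -> 0 <= h x) ->
  {ae mu, forall x, D x -> f x <= h x} ->
  \int[mu]_(x in D) f x <= \int[mu]_(x in D) h x.
Proof.
move=> mD fi hi f0 h0 fh; apply: fine_le.
- exact: integrable_fin_num.
- exact: integrable_fin_num.
apply: ae_ge0_le_integral => //.
- exact: measurable_int fi.
- exact: measurable_int hi.
Qed.

Lemma subset_le_Rintegral (A D : set T) f : measurable A -> measurable D ->
  A `<=` D -> mu.-integrable D (EFin \o f) -> (forall x, D x -> 0 <= f x) ->
  \int[mu]_(x in A) f x <= \int[mu]_(x in D) f x.
Proof.
move=> mA mD AD fi f0; apply: fine_le.
- by apply: integrable_fin_num => //; exact: integrableS fi.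
- exact: integrable_fin_num.
apply: ge0_subset_integral => //; exact: measurable_int fi.
Qed.

End Rintegral_ae.

(** * Comparison of two paths driven by the same field *)

Section two_paths.
Context {R : realType} (alpha : R).
Hypotheses (alpha0 : 0 < alpha) (alpha1 : alpha < 1).
Local Notation mu := (@lebesgue_measure R).
Variables (t N : R) (x : R * R) (f f' : R -> torus R) (g g' z z' : R -> R * R).
Hypotheses (t0 : 0 < t) (N0 : 0 <= N).
Local Notation D := (`[0%R, t]%classic : set (measurableTypeR R)).

Hypothesis fE : forall s, 0 <= s <= t -> f s = torus_mod (x +
  (\int[mu]_(r in `[0, s]) (g r).1, \int[mu]_(r in `[0, s]) (g r).2) + z s).
Hypothesis fE' : forall s, 0 <= s <= t -> f' s = torus_mod (x +
  (\int[mu]_(r in `[0, s]) (g' r).1, \int[mu]_(r in `[0, s]) (g' r).2) + z' s).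
Hypotheses (mg : measurable_fun D g) (mg' : measurable_fun D g').
Hypothesis gN : {ae mu, forall s, D s ->
  [/\ enorm (g s) <= N, enorm (g' s) <= N &
      enorm (g s - g' s) <= N * torus_dist (f s) (f' s) `^ alpha]}.
Hypothesis zi : mu.-integrable D (fun s => (enorm (z s) ^+ 2)%:E).
Hypothesis zi' : mu.-integrable D (fun s => (enorm (z' s) ^+ 2)%:E).

(** Since [J1] and [J2] are integrals over the whole of [D], they control the
    difference of the drift parts at all times of [D] simultaneously: they play
    the role of its supremum. *)
Let J1 := \int[mu]_(r in D) `|(g r).1 - (g' r).1|.
Let J2 := \int[mu]_(r in D) `|(g r).2 - (g' r).2|.

Let muD : mu D = t%:E.
Proof. by rewrite lebesgue_measure_itv/= lte_fin t0 -EFinD subr0. Qed.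

Let Dfin : (mu D < +oo)%E.
Proof. by rewrite muD ltry. Qed.

Let mD : measurable D. Proof. exact: measurable_itv. Qed.

Let drift_integrable : [/\ mu.-integrable D (EFin \o (fun r => (g r).1)),
  mu.-integrable D (EFin \o (fun r => (g r).2)),
  mu.-integrable D (EFin \o (fun r => (g' r).1)) &
  mu.-integrable D (EFin \o (fun r => (g' r).2))].
Proof.
have m1 h : measurable_fun D h -> measurable_fun D (fun r => (h r : R * R).1).
  by move=> mh; exact: (measurable_comp measurableT (@subsetT _ _) measurable_fst mh).
have m2 h : measurable_fun D h -> measurable_fun D (fun r => (h r : R * R).2).
  by move=> mh; exact: (measurable_comp measurableT (@subsetT _ _) measurable_snd mh).
have bi (h : R -> R) : measurable_fun D h -> {ae mu, forall r, D r -> `|h r| <= N} ->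
    mu.-integrable D (EFin \o h).
  move=> mh hN; exact (@ae_bounded_integrable _ _ _ mu D h N mD Dfin mh hN).
split; apply: bi; [exact: m1| |exact: m2| |exact: m1| |exact: m2|];
  apply: (ae_imp _ gN) => s gNs Ds; have [h h' _] := gNs Ds.
- exact: le_trans (norm1_le_enorm _) h.
- exact: le_trans (norm2_le_enorm _) h.
- exact: le_trans (norm1_le_enorm _) h'.
- exact: le_trans (norm2_le_enorm _) h'.
Qed.

Let diff_integrable :
  mu.-integrable D (EFin \o (fun r => `|(g r).1 - (g' r).1|)) /\
  mu.-integrable D (EFin \o (fun r => `|(g r).2 - (g' r).2|)).
Proof.
have [i1 i2 i1' i2'] := drift_integrable.
by split; apply: integrable_dist.
Qed.

Let delta_le (h h' : R -> R) s : 0 <= s <= t ->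
  mu.-integrable D (EFin \o h) -> mu.-integrable D (EFin \o h') ->
  `|\int[mu]_(r in `[0, s]) h r - \int[mu]_(r in `[0, s]) h' r| <=
  \int[mu]_(r in D) `|h r - h' r|.
Proof.
move=> /andP[s0 st] hi hi'.
have sD : (`[0, s]%classic : set (measurableTypeR R)) `<=` D.
  by apply: subset_itvl; rewrite bnd_simp.
have ms : measurable (`[0, s]%classic : set (measurableTypeR R)).
  exact: measurable_itv.
have his := integrableS mD ms sD hi; have hi's := integrableS mD ms sD hi'.
rewrite -RintegralB//; apply: le_trans (le_normr_Rintegral _ _) _ => //.
  exact: (integrableB ms his hi's).
apply: subset_le_Rintegral => //.
exact: integrable_dist.
Qed.

(** Lift to the plane, then split the difference of the lifts into drift part and
    the two noises with [(e + k - m)^2 <= 3 (e^2 + k^2 + m^2)]. *)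
Let dist_sqr_le s : 0 <= s <= t -> torus_dist (f s) (f' s) ^+ 2 <=
  3 * (J1 + J2) ^+ 2 + 3 * (enorm (z s) ^+ 2 + enorm (z' s) ^+ 2).
Proof.
move=> st; have [i1 i2 i1' i2'] := drift_integrable.
have d1 := delta_le st i1 i1'; have d2 := delta_le st i2 i2'.
rewrite (fE st) (fE' st).
set p := _ + z s; set q := _ + z' s.
have : torus_dist (torus_mod p) (torus_mod q) ^+ 2 <= enorm (p - q) ^+ 2.
  by rewrite ler_sqr ?nnegrE ?torus_dist_ge0 ?enorm_ge0// torus_dist_mod_le.
move=> /le_trans; apply; rewrite !enorm_sqr /p /q /=.
set a := \int[mu]_(r in _) (g r).1; set b := \int[mu]_(r in _) (g r).2.
set a' := \int[mu]_(r in _) (g' r).1; set b' := \int[mu]_(r in _) (g' r).2.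
have J10 : 0 <= J1 by apply: Rintegral_ge0 => r _.
have J20 : 0 <= J2 by apply: Rintegral_ge0 => r _.
have aJ : (a - a') ^+ 2 <= J1 ^+ 2.
  by rewrite -real_normK ?num_real// ler_sqr ?nnegrE.
have bJ : (b - b') ^+ 2 <= J2 ^+ 2.
  by rewrite -real_normK ?num_real// ler_sqr ?nnegrE.
have JJ : J1 ^+ 2 + J2 ^+ 2 <= (J1 + J2) ^+ 2.
  by rewrite sqrrD; have := mulr_ge0 J10 J20; lra.
have cs (e k m : R) : (e + k - m) ^+ 2 <= 3 * (e ^+ 2 + k ^+ 2 + m ^+ 2).
  have := sqr_ge0 (e - k); have := sqr_ge0 (e + m); have := sqr_ge0 (k + m).
  lra.
have := cs (a - a') (z s).1 (z' s).1; have := cs (b - b') (z s).2 (z' s).2.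
have -> : x.1 + a + (z s).1 - (x.1 + a' + (z' s).1) =
  a - a' + (z s).1 - (z' s).1 by lra.
have -> : x.2 + b + (z s).2 - (x.2 + b' + (z' s).2) =
  b - b' + (z s).2 - (z' s).2 by lra.
lra.
Qed.

Let E := \int[mu]_(s in D) (enorm (z s) ^+ 2) + \int[mu]_(s in D) (enorm (z' s) ^+ 2).

(** With [2 * N] from passing to the l1 norm, the quadratic bound integrates to
    [2 * N * B `^ alpha * (4 * t + 3 * E / B ^+ 2)], and the bracket is at most
    [7 * t]. *)
Let drift_le (B : R) : 0 < B -> J1 + J2 <= B -> E <= t * B ^+ 2 ->
  J1 + J2 <= 14 * N * t * B `^ alpha.
Proof.
move=> B0 JB EB; have [i1 i2] := diff_integrable.
have B20 : 0 < B ^+ 2 by rewrite exprn_gt0.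
rewrite /J1 /J2 -RintegralD//.
pose K := 2 * N * B `^ alpha.
have K0 : 0 <= K by rewrite !mulr_ge0// powR_ge0.
pose h s := K * (4 + 3 / B ^+ 2 * (enorm (z s) ^+ 2 + enorm (z' s) ^+ 2)).
have zzi : mu.-integrable D (EFin \o (fun s => enorm (z s) ^+ 2 + enorm (z' s) ^+ 2)).
  exact: (integrableD mD zi zi').
have c4i : mu.-integrable D (EFin \o (fun=> 4 : R)).
  apply: (@ae_bounded_integrable _ _ _ mu D (fun=> 4) 4 mD Dfin) => //.
  by apply: aeW => s _; rewrite ger0_norm.
have zz3i : mu.-integrable D (EFin \o (fun s => 3 / B ^+ 2 *
    (enorm (z s) ^+ 2 + enorm (z' s) ^+ 2))).
  exact: (integrableZl mD (3 / B ^+ 2) zzi).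
have h4i : mu.-integrable D (EFin \o (fun s => 4 + 3 / B ^+ 2 *
    (enorm (z s) ^+ 2 + enorm (z' s) ^+ 2))).
  exact: (integrableD mD c4i zz3i).
have hi : mu.-integrable D (EFin \o h) by exact: (integrableZl mD K h4i).
apply: (@le_trans _ _ (\int[mu]_(s in D) h s)).
  apply: ae_le_Rintegral => //.
  - exact: (integrableD mD i1 i2).
  - move=> s _; rewrite /h mulr_ge0// addr_ge0// mulr_ge0 ?divr_ge0 ?sqr_ge0//.
    by rewrite addr_ge0// sqr_ge0.
  apply: (ae_imp _ gN) => s gNs Ds; have [_ _ gd] := gNs Ds.
  have n1 := norm1_le_enorm (g s - g' s); have n2 := norm2_le_enorm (g s - g' s).
  have st : 0 <= s <= t by move: Ds; rewrite /= in_itv.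
  have dp := powR_le_quadratic alpha0 alpha1 B0 (torus_dist_ge0 (f s) (f' s)).
  have ds := dist_sqr_le st.
  have J0 : 0 <= J1 + J2 by rewrite addr_ge0// Rintegral_ge0.
  have J2B : (J1 + J2) ^+ 2 <= B ^+ 2 by rewrite ler_sqr ?nnegrE// ltW.
  apply: (@le_trans _ _ (2 * (N * torus_dist (f s) (f' s) `^ alpha))).
    by move: n1 n2 gd => /=; lra.
  rewrite /h /K -!mulrA; do 2 apply: ler_wpM2l => //.
  apply: le_trans dp _; apply: ler_wpM2l; first exact: powR_ge0.
  rewrite (_ : 4 + _ = 1 + (3 * B ^+ 2 +
      3 * (enorm (z s) ^+ 2 + enorm (z' s) ^+ 2)) / B ^+ 2).
    rewrite lerD2l ler_pM2r ?invr_gt0//; lra.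
  by field; rewrite gt_eqF.
rewrite /h RintegralZl// (RintegralD mD c4i zz3i) RintegralZl//.
rewrite (RintegralD mD zi zi') Rintegral_cst//.
rewrite -/E [X in 4 * fine X]muD /=.
rewrite (_ : 14 * N * t * B `^ alpha = K * (7 * t)); last by rewrite /K; lra.
apply: ler_wpM2l => //.
have : 3 / B ^+ 2 * E <= 3 * t by rewrite mulrAC ler_pdivrMr//; lra.
lra.
Qed.

(** The pathwise form of the theorem: the noise enters through its value at
    time [t] and through any [A] dominating its root mean square on [[0, t]]. *)
Lemma two_paths_dist_le (A : R) : 0 < A -> E <= t * A ^+ 2 ->
  torus_dist (f t) (f' t) ^+ 2 <=
  6 * A ^+ 2 + 6 * (14 * N * t) `^ (2 / (1 - alpha)) +
  3 * (enorm (z t) ^+ 2 + enorm (z' t) ^+ 2).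
Proof.
move=> A0 EA.
have J0 : 0 <= J1 + J2 by rewrite addr_ge0// Rintegral_ge0.
have K0 : 0 <= 14 * N * t by rewrite !mulr_ge0// ltW.
have := @sublinear_fixpoint_le R alpha alpha1 A (J1 + J2) _ A0 J0 K0.
have h B : A <= B -> J1 + J2 <= B -> J1 + J2 <= 14 * N * t * B `^ alpha.
  move=> AB JB; apply: drift_le => //; first exact: lt_le_trans AB.
  apply: (le_trans EA); rewrite ler_pM2l// ler_sqr ?nnegrE ?(ltW A0)//.
  exact: le_trans (ltW A0) AB.
move=> /(_ h); set G := _ `^ _ => JAG.
have G0 : 0 <= G by exact: powR_ge0.
have -> : (14 * N * t) `^ (2 / (1 - alpha)) = G ^+ 2.
  by rewrite /G -powR_mulrn ?powR_ge0// -powRrM [_^-1 * _]mulrC.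
have tt : 0 <= t <= t by rewrite lexx ltW.
have := dist_sqr_le tt.
have : (J1 + J2) ^+ 2 <= (A + G) ^+ 2 by rewrite ler_sqr ?nnegrE// addr_ge0// ltW.
have := sqr_ge0 (A - G); lra.
Qed.

End two_paths.

(** * Pointwise bounds from the Hölder norm *)

Section holder_bounds.
Context {R : realType} (alpha : R).
Implicit Types (v : torus R -> R * R) (y z : torus R).

(** Hence the supremum over pairs of distinct points is over a nonempty set, and
    the sum of the two suprema dominates each of them. *)
Let torus_two_points : exists p : torus R * torus R, p.1 <> p.2.
Proof.
pose inD (r : R * R) := (0 <= r.1 < Num.sqrt 2) && (0 <= r.2 < 1).
have h (b : R) : 0 <= b < 1 -> inD (0, b).
  by rewrite /inD /= => ->; rewrite lexx sqrtr_gt0 ltr0n.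
have h0 : 0 <= (0 : R) < 1 by rewrite lexx ltr01.
have h1 : 0 <= (2^-1 : R) < 1 by rewrite invr_ge0 ler0n invf_lt1 ?ltr1n.
exists (Torus (h _ h0), Torus (h _ h1)).
move=> /(congr1 (fun y => (torus_rep y).2)) /= /esym/eqP.
by rewrite invr_eq0 pnatr_eq0.
Qed.

Let sup_ge0 v :
  (0 <= ereal_sup [set (enorm (v y))%:E | y in [set: torus R]])%E.
Proof.
apply: (@le_trans _ _ (enorm (v (torus_mod 0)))%:E).
  by rewrite lee_fin enorm_ge0.
by apply: ereal_sup_ubound; exists (torus_mod 0).
Qed.

Let quotient_sup_ge0 v :
  (0 <= ereal_sup [set (enorm (v p.1 - v p.2) / torus_dist p.1 p.2 `^ alpha)%:E
                  | p in [set p : torus R * torus R | p.1 <> p.2]])%E.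
Proof.
have [[y z] /= yz] := torus_two_points.
apply: (@le_trans _ _ (enorm (v y - v z) / torus_dist y z `^ alpha)%:E).
  by rewrite lee_fin divr_ge0// ?enorm_ge0 ?powR_ge0.
by apply: ereal_sup_ubound; exists (y, z).
Qed.

Lemma Linf_holder_norm_ge0 (u : R -> torus R -> R * R) :
  (0 <= Linf_holder_norm alpha u)%E.
Proof.
apply: ess_sup_gee; last by apply: aeW => s; exact: adde_ge0.
by rewrite /= /mrestr setTI lebesgue_measure_itv/= lte_fin ltr01 -EFinD subr0 lte01.
Qed.

Lemma holder_norm_bounds v (N : R) : (holder_norm alpha v <= N%:E)%E ->
  (forall y, enorm (v y) <= N) /\
  (forall y z, enorm (v y - v z) <= N * torus_dist y z `^ alpha).
Proof.
have S10 := sup_ge0 v; have S20 := quotient_sup_ge0 v.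
rewrite /holder_norm; set S1 := ereal_sup _ in S10 *.
set S2 := ereal_sup _ in S20 * => SN.
have S1y y : ((enorm (v y))%:E <= S1)%E by apply: ereal_sup_ubound; exists y.
have S2yz y z : y <> z ->
    ((enorm (v y - v z) / torus_dist y z `^ alpha)%:E <= S2)%E.
  by move=> yz; apply: ereal_sup_ubound; exists (y, z).
have S1N : (S1 <= N%:E)%E by apply: le_trans SN; rewrite leeDl.
have S2N : (S2 <= N%:E)%E by apply: le_trans SN; rewrite leeDr.
have vN y : enorm (v y) <= N by rewrite -lee_fin (le_trans (S1y y)).
split=> // y z; have N0 : 0 <= N by apply: le_trans (vN y); exact: enorm_ge0.
have [->|/eqP yz] := eqVneq y z.
  by rewrite subrr /enorm/= expr0n addr0 sqrtr0 mulr_ge0// powR_ge0.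
rewrite -ler_pdivrMr; last by rewrite powR_gt0// torus_dist_gt0.
by rewrite -lee_fin (le_trans (S2yz y z yz)).
Qed.

Lemma ae_holder_norm_le (u : R -> torus R -> R * R) :
  (Linf_holder_norm alpha u < +oo)%E ->
  {ae (@lebesgue_measure R), forall s, (`[0%R, 1]%classic : set R) s ->
    (holder_norm alpha (u s) <= (fine (Linf_holder_norm alpha u))%:E)%E}.
Proof.
set L := Linf_holder_norm alpha u => Loo.
have LN : (L <= (fine L)%:E)%E.
  by move: Loo; case: (L) => [r| |] //= _; exact: leNye.
have [A [mA A0 sA]] := ess_sup_ge (mrestr lebesgue_measure (@measurable_itv R `[0, 1]))
  (fun t => holder_norm alpha (u t)).
exists (A `&` `[0, 1]%classic); split.
- by apply: measurableI => //; exact: measurable_itv.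
- exact: A0.
move=> s /= /not_implyP[s01 hs]; split => //; apply: sA => /= h; apply: hs.
exact: le_trans h LN.
Qed.

End holder_bounds.

(** * Variance of the solution *)

Section variance_of_solution.
Context {R : realType} (alpha : R).
Hypotheses (alpha0 : 0 < alpha) (alpha1 : alpha < 1).
Variables (u : R -> torus R -> R * R).
Hypothesis hu : Linf_holder alpha u.
Variables (kappa : R) (x : torus R).
Hypothesis kappa0 : 0 < kappa.
Context d (Omega : measurableType d) (P : probability Omega R)
  (F : R -> set (set Omega)) (w : R -> Omega -> R * R)
  (X : R -> {RV P >-> torus R}).
Hypotheses (hF : filtration01 F) (hw : brownian_motion01 P F w)
  (hX : sde_solution P F w u kappa x X).
Local Notation N := (fine (Linf_holder_norm alpha u)).
Local Notation mu := (@lebesgue_measure R).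

Lemma torus_var_le (Y : {RV P >-> torus R}) (a : torus R) :
  (torus_var Y <= \int[P]_o ((torus_dist (Y o) a) ^+ 2)%:E)%E.
Proof.
have -> : (\int[P]_o ((torus_dist (Y o) a) ^+ 2)%:E =
    \int[distribution P Y]_y ((torus_dist y a) ^+ 2)%:E)%E.
  rewrite ge0_integral_distribution// => [|y]; last by rewrite lee_fin sqr_ge0.
  by apply/measurable_EFinP; apply: measurable_funX; exact: measurable_torus_dist.
by apply: ereal_inf_lbound; exists a.
Qed.

(** At time [0] the solution is almost surely at [x]. The case is separate because
    time averages are divided by [t] below. *)
Lemma torus_var0 : (torus_var (X 0) <= 0)%E.
Proof.
apply: le_trans (torus_var_le _ x) _.
rewrite [leRHS](_ : _ = \int[P]_o 0)%E; last by rewrite integral0.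
apply: ae_ge0_le_integral => //.
- by move=> o _; rewrite lee_fin sqr_ge0.
- apply/measurable_EFinP; apply: measurable_funX.
  by apply: (measurableT_comp (measurable_torus_dist x)).
case: hw => _ w0 _ _ _; case: hX => _ _ XE.
apply: filterS2 w0 XE => o w0 XE _.
rewrite XE ?lexx ?ler01// w0 scaler0 addr0 set_itv1 !Rintegral_set1.
by rewrite (_ : (0, 0) = 0)// addr0 torus_repK torus_dist_xx expr0n.
Qed.

Variable t : R.
Hypothesis t01 : 0 < t <= 1.
Let t0 : 0 < t. Proof. by case/andP: t01. Qed.
Let t1 : t <= 1. Proof. by case/andP: t01. Qed.

(** The almost sure properties of a sample under which it can be compared with
    another one. *)
Let good (o : Omega) : Prop := [/\
  mu.-integrable `[0, t] (fun s : measurableTypeR R => (enorm (w s o) ^+ 2)%:E),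
  ((\int[mu]_(s in `[0%R, t]) (enorm (w s o) ^+ 2))%:E <= energy w t o)%E,
  measurable_fun (`[0, 1]%classic : set R) (fun s => X s o) &
  forall s, 0 <= s <= 1 -> X s o = torus_mod (torus_rep x +
    (\int[mu]_(r in `[0, s]) (u r (X r o)).1,
     \int[mu]_(r in `[0, s]) (u r (X r o)).2) + Num.sqrt (2 * kappa) *: w s o)].

Let ae_good : {ae P, forall o, good o}.
Proof.
have h1 := integral_le_energy hw t01.
case: hX => _ h2 h3; apply: filterS3 h1 h2 h3 => o [h11 h12] h2 h3.
split=> //; apply: measurable_torus_path; first exact: measurable_itv.
by move=> s; rewrite /= in_itv/= => s01; exact: h2.
Qed.

Let N0 : 0 <= N.
Proof. by rewrite fine_ge0// Linf_holder_norm_ge0. Qed.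

Let drift_measurable o : good o -> measurable_fun
  (`[0, t]%classic : set (measurableTypeR R)) (fun s => u s (X s o)).
Proof.
move=> [_ _ mX _]; have [mu_ _] := hu.
have mi : measurable_fun (`[0, 1]%classic : set R) (fun s : R => s).
  exact: measurable_id.
have sub : (`[0, t]%classic : set R) `<=` `[0, 1]%classic.
  by apply: subset_itvl; rewrite bnd_simp.
have := measurable_fun_pair_in mi mX => mp.
have m01 : measurable ((`[0, 1]%classic : set R) `*` [set: torus R]).
  by apply: measurableX => //; exact: measurable_itv.
apply: (@measurable_funS _ _ _ _ (`[0, 1]%classic : set R)) => //.
apply: (measurable_comp m01 _ mu_ mp).
by move=> _ [s s01 <-].
Qed.

Let noise (o : Omega) : R :=
  t^-1 * \int[mu]_(s in `[0%R, t]) (enorm (w s o) ^+ 2) + enorm (w t o) ^+ 2.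

(** [two_paths_dist_le] with [A ^+ 2] equal to the mean square of the two noises
    plus [kappa * t]; the extra term keeps [A] positive and is of the order of
    the final bound. *)
Let pair_dist_le o o' : good o -> good o' ->
  torus_dist (X t o) (X t o') ^+ 2 <=
  12 * kappa * (noise o + noise o' + t) +
  6 * (14 * N * t) `^ (2 / (1 - alpha)).
Proof.
rewrite /noise => go go'.
have k20 : 0 <= 2 * kappa by rewrite mulr_ge0// ltW.
have zE v : enorm (Num.sqrt (2 * kappa) *: v) ^+ 2 = 2 * kappa * enorm v ^+ 2 :> R.
  by rewrite !enorm_sqr /= !exprMn sqr_sqrtr// mulrDr.
have mg := drift_measurable go; have mg' := drift_measurable go'.
have [wi _ _ XE] := go; have [wi' _ _ XE'] := go'.
set Q := \int[mu]_(s in _) (enorm (w s o) ^+ 2).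
set Q' := \int[mu]_(s in _) (enorm (w s o') ^+ 2).
have Q0 : 0 <= Q by apply: Rintegral_ge0 => s _; exact: sqr_ge0.
have Q'0 : 0 <= Q' by apply: Rintegral_ge0 => s _; exact: sqr_ge0.
have st1 s : 0 <= s <= t -> 0 <= s <= 1.
  by move=> /andP[-> /le_trans]; exact.
have mD : measurable (`[0, t]%classic : set (measurableTypeR R)).
  exact: measurable_itv.
pose z s := Num.sqrt (2 * kappa) *: w s o.
pose z' s := Num.sqrt (2 * kappa) *: w s o'.
have zsE s : enorm (z s) ^+ 2 = 2 * kappa * enorm (w s o) ^+ 2 by exact: zE.
have zsE' s : enorm (z' s) ^+ 2 = 2 * kappa * enorm (w s o') ^+ 2 by exact: zE.
have zi : mu.-integrable `[0, t] (fun s : measurableTypeR R => (enorm (z s) ^+ 2)%:E).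
  rewrite (_ : (fun _ => _) = (fun s => (2 * kappa)%:E * (enorm (w s o) ^+ 2)%:E)%E).
    exact: integrableZl.
  by apply/funext => s; rewrite zsE EFinM.
have zi' : mu.-integrable `[0, t] (fun s : measurableTypeR R => (enorm (z' s) ^+ 2)%:E).
  rewrite (_ : (fun _ => _) = (fun s => (2 * kappa)%:E * (enorm (w s o') ^+ 2)%:E)%E).
    exact: integrableZl.
  by apply/funext => s; rewrite zsE' EFinM.
have gN : {ae mu, forall s, (`[0, t]%classic : set (measurableTypeR R)) s ->
    [/\ enorm (u s (X s o)) <= N, enorm (u s (X s o')) <= N &
      enorm (u s (X s o) - u s (X s o')) <= N * torus_dist (X s o) (X s o') `^ alpha]}.
  apply: (ae_imp _ (ae_holder_norm_le hu.2)) => s hs; rewrite /= in_itv/= => st.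
  have [] := @holder_norm_bounds R alpha (u s) N.
    by apply: hs; rewrite /= in_itv/=; exact: st1.
  by move=> h1 h2; split.
pose A := Num.sqrt (2 * kappa * (Q + Q') / t + kappa * t).
have B0 : 0 < 2 * kappa * (Q + Q') / t + kappa * t.
  rewrite ltr_wpDl//; last by rewrite mulr_gt0.
  by apply: divr_ge0 (ltW t0); rewrite mulr_ge0// addr_ge0.
have A0 : 0 < A by rewrite sqrtr_gt0.
have A2 : A ^+ 2 = 2 * kappa * (Q + Q') / t + kappa * t by rewrite sqr_sqrtr// ltW.
have := @two_paths_dist_le R alpha alpha0 alpha1 t N (torus_rep x)
  (fun s => X s o) (fun s => X s o') (fun s => u s (X s o)) (fun s => u s (X s o'))
  z z' t0 N0 (fun s st => XE s (st1 s st)) (fun s st => XE' s (st1 s st))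
  mg mg' gN zi zi' A A0.
have EQ : \int[mu]_(s in `[0, t]) (enorm (z s) ^+ 2) = 2 * kappa * Q.
  by rewrite /Q -RintegralZl//; apply: eq_Rintegral => s _; rewrite zsE.
have EQ' : \int[mu]_(s in `[0, t]) (enorm (z' s) ^+ 2) = 2 * kappa * Q'.
  by rewrite /Q' -RintegralZl//; apply: eq_Rintegral => s _; rewrite zsE'.
have EA : 2 * kappa * Q + 2 * kappa * Q' <=
    t * (2 * kappa * (Q + Q') / t + kappa * t).
  rewrite -mulrDr [leRHS]mulrDr [t * (_ / t)]mulrC divfK ?gt_eqF// lerDl.
  by apply: mulr_ge0 (ltW t0) _; rewrite mulr_ge0// ltW.
rewrite EQ EQ' A2 zsE zsE' => /(_ EA)/le_trans; apply.
have w1 := sqr_ge0 (enorm (w t o)); have w2 := sqr_ge0 (enorm (w t o')).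
have kw1 := mulr_ge0 (ltW kappa0) w1; have kw2 := mulr_ge0 (ltW kappa0) w2.
have kt := mulr_ge0 (ltW kappa0) (ltW t0).
set G := _ `^ _.
have -> : 2 * kappa * (Q + Q') / t = 2 * kappa * (t^-1 * Q + t^-1 * Q') by ring.
move: kw1 kw2 kt; move: (t^-1 * Q) (t^-1 * Q') (enorm (w t o) ^+ 2) => q q' e.
by move: (enorm (w t o') ^+ 2) G => e' G kw1 kw2 kt; lra.
Qed.

(** A measurable majorant of [noise] on good samples. *)
Let Y (o : Omega) : \bar R := ((t^-1)%:E * energy w t o + (enorm (w t o) ^+ 2)%:E)%E.

Let t01' : 0 <= t <= 1. Proof. by rewrite ltW. Qed.

Let mY : measurable_fun setT Y.
Proof.
apply: emeasurable_funD.
  by apply: emeasurable_funM => //; exact: (measurable_energy hF hw).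
by apply/measurable_EFinP; exact: (measurable_enorm_brownian hF hw).
Qed.

Let Y0 o : (0 <= Y o)%E.
Proof.
apply: adde_ge0; last by rewrite lee_fin sqr_ge0.
by apply: mule_ge0; [rewrite lee_fin invr_ge0 ltW|exact: energy_ge0].
Qed.

Let integral_Y : (\int[P]_o Y o <= (32 * t)%:E)%E.
Proof.
have ti0 : 0 <= t^-1 by rewrite invr_ge0 ltW.
have me := measurable_energy hF hw t01'.
rewrite ge0_integralD//; last 4 first.
- by move=> o _; apply: mule_ge0; [rewrite lee_fin|exact: energy_ge0].
- exact: emeasurable_funM.
- by move=> o _; rewrite lee_fin sqr_ge0.
- by apply/measurable_EFinP; exact: (measurable_enorm_brownian hF hw).
rewrite ge0_integralZl_EFin//; last by move=> o _; exact: energy_ge0.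
have -> : (32 * t)%:E = ((t^-1)%:E * (16 * t ^+ 2)%:E + (16 * t)%:E)%E.
  by rewrite -EFinM -EFinD; congr EFin; field; rewrite gt_eqF.
apply: leeD; last exact: (brownian_second_moment_le hF hw).
by apply: lee_wpmul2l; [rewrite lee_fin|exact: (integral_energy_le hF hw)].
Qed.

(** Otherwise [Y] would exceed twice its mean almost surely. *)
Let exists_good : exists2 o, good o & (Y o <= (64 * t)%:E)%E.
Proof.
apply: contrapT => no.
have h : {ae P, forall o, setT o -> ((64 * t)%:E <= Y o)%E}.
  apply: filterS ae_good => o go _; rewrite leNgt; apply/negP => /ltW Yo.
  by apply: no; exists o.
have : (\int[P]_o (64 * t)%:E <= \int[P]_o Y o)%E.
  apply: ae_ge0_le_integral => //.
  by move=> o _; rewrite lee_fin mulr_ge0// ltW.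
move=> /le_trans/(_ integral_Y); rewrite integral_cst//= probability_setT mule1 lee_fin.
by rewrite leNgt ltr_pM2r// ltr_nat.
Qed.

(** The centre is the position of a sample given by [exists_good]; the
    expectation of [Y] accounts for the other sample. *)
Lemma torus_var_sde_le : (torus_var (X t) <=
  (1164 * (kappa * t) + 6 * (14 * N * t) `^ (2 / (1 - alpha)))%:E)%E.
Proof.
have [b gb Yb] := exists_good.
set G := _ `^ _; have G0 : 0 <= G by exact: powR_ge0.
apply: le_trans (torus_var_le _ (X t b)) _.
have k12 : 0 <= 12 * kappa by rewrite mulr_ge0// ltW.
(* [65 * t] collects the [64 * t] of [Y b] and the [t] of [pair_dist_le]. *)
apply: (@le_trans _ _ (\int[P]_o ((12 * kappa)%:E * Y o +
    (12 * kappa * (65 * t) + 6 * G)%:E))%E).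
  apply: ae_ge0_le_integral => //.
  - by move=> o _; rewrite lee_fin sqr_ge0.
  - apply/measurable_EFinP; apply: measurable_funX.
    by apply: (measurableT_comp (measurable_torus_dist _)).
  - move=> o _; apply: adde_ge0; first by rewrite mule_ge0.
    by rewrite lee_fin addr_ge0 ?mulr_ge0// ltW.
  - by apply: emeasurable_funD => //; exact: emeasurable_funM.
  apply: filterS ae_good => o go _.
  have := pair_dist_le go gb; rewrite -/G.
  move=> h.
  have qY (p : Omega) : good p -> ((noise p)%:E <= Y p)%E.
    move=> [_ hp _ _]; rewrite /noise EFinD EFinM; apply: leeD => //.
    by apply: lee_wpmul2l => //; rewrite lee_fin invr_ge0 ltW.
  have q64 : noise b <= 64 * t by rewrite -lee_fin (le_trans (qY b gb)).
  apply: (@le_trans _ _ ((12 * kappa) * noise o + (12 * kappa * (65 * t) + 6 * G))%:E).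
    rewrite lee_fin; apply: le_trans h _.
    by have := ler_wpM2l k12 q64; lra.
  rewrite EFinD EFinM; apply: leeD => //; apply: lee_wpmul2l; first by rewrite lee_fin.
  exact: qY.
rewrite ge0_integralD//; last 3 first.
- by move=> o _; rewrite mule_ge0.
- exact: emeasurable_funM.
- by move=> o _; rewrite lee_fin addr_ge0 ?mulr_ge0// ltW.
rewrite ge0_integralZl_EFin// integral_cst//= probability_setT mule1.
have -> : (1164 * (kappa * t) + 6 * G)%:E =
    ((12 * kappa)%:E * (32 * t)%:E + (12 * kappa * (65 * t) + 6 * G)%:E)%E.
  by rewrite -EFinM -EFinD; congr EFin; ring.
by apply: leeD => //; apply: lee_wpmul2l; rewrite ?lee_fin.
Qed.

End variance_of_solution.

Theorem proposition1p9 (R : realType) (alpha : R)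
    (halpha0 : 0 < alpha) (halpha1 : alpha < 1) :
  exists C : R, 0 < C /\
    forall (u : R -> torus R -> R * R), Linf_holder alpha u ->
    forall (kappa : R), 0 < kappa -> kappa < 1 ->
    forall (x : torus R) (t : R), 0 <= t -> t <= 1 ->
    forall (d : measure_display) (Omega : measurableType d)
      (P : probability Omega R) (F : R -> set (set Omega))
      (w : R -> Omega -> R * R) (X : R -> {RV P >-> torus R}),
    filtration01 F -> brownian_motion01 P F w ->
    sde_solution P F w u kappa x X ->
    (torus_var (X t) <=
     (C * (kappa * t +
           (fine (Linf_holder_norm alpha u) * t) `^ (2 / (1 - alpha))))%:E)%E.
Proof.
pose p := 2 / (1 - alpha); have Kp : 0 <= 14 `^ p :> R by exact: powR_ge0.
have C0 : 0 < 1164 :> R by rewrite ltr0n.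
have C1 : 0 <= 6 * 14 `^ p :> R by apply: mulr_ge0.
exists (1164 + 6 * 14 `^ p); split; first exact: ltr_wpDr C1 C0.
move=> u hu kappa k0 k1 x t t0 t1 d Omega P F w X hF hw hX.
have H0 : 0 <= (fine (Linf_holder_norm alpha u) * t) `^ p by exact: powR_ge0.
have kt0 : 0 <= kappa * t by rewrite mulr_ge0// ltW.
have [tE|tn0] := eqVneq t 0.
  rewrite tE; apply: le_trans (torus_var0 hw hX) _.
  by rewrite lee_fin mulr_ge0 ?addr_ge0 ?mulr_ge0 ?powR_ge0// ltW.
have t01 : 0 < t <= 1 by rewrite lt_neqAle eq_sym tn0 t0 t1.
apply: le_trans (torus_var_sde_le halpha0 halpha1 hu k0 hF hw hX t01) _.
have -> : (14 * fine (Linf_holder_norm alpha u) * t) `^ p =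
    14 `^ p * (fine (Linf_holder_norm alpha u) * t) `^ p.
  by rewrite -mulrA powRM// mulr_ge0// fine_ge0// Linf_holder_norm_ge0.
rewrite lee_fin -/p; set H := _ `^ p in H0 *; set K := 14 `^ p in Kp *.
by have := mulr_ge0 Kp kt0; lra.
Qed.
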